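(* Let $I\subset R=\mathbb{K}[x_1,\ldots,x_n]$ be a monomial ideal minimally generated by monomials $f_1,\ldots,f_m$ ($m\ge 2$) such that for each $k=2,\ldots,m$ the colon ideal $(f_1,\ldots,f_{k-1}):f_k$ is generated by a regular sequence $\alpha_{k,1},\ldots,\alpha_{k,r_k}$ of monomials with $\deg(\alpha_{k,i})=a_{k,i}$. Let $d_k=\deg(f_k)$ and put $$Q(I)=\max\{d_k+a_{k,1}+\cdots+a_{k,r_k}-r_k: 2\le k\le m\},\qquad P(I)=\max\{r_2,\ldots,r_m\}.$$ Let $D(I)$ be the degree of the polynomial $(1-t)^nHS(I,t)$. If $P(I)+Q(I)=D(I)$, then $\mathrm{reg}(I)=Q(I)$ and $\mathrm{pdim}(I)=P(I)$. Moreover, in this case $\beta_{P(I),\,P(I)+Q(I)}(I)$ is the unique extremal Betti number of $I$.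
   Context: $\mathbb{K}$ is a field and $R=\mathbb{K}[x_1,\ldots,x_n]$ is the standard graded polynomial ring. For a finitely generated graded $R$-module $M$, $\beta_{i,j}(M)=\dim_{\mathbb{K}}\mathrm{Tor}_i^R(M,\mathbb{K})_j$, $\mathrm{reg}(M)=\max\{j-i:\beta_{i,j}(M)\neq 0\}$, $\mathrm{pdim}(M)=\max\{i:\beta_{i,j}(M)\ne 0\text{ for some }j\}$, and $HS(M,t)=\sum_{i\in\mathbb{Z}}\dim_{\mathbb{K}}(M_i)t^i$. A Betti number $\beta_{i,i+j}(M)\ne 0$ is called extremal if $\beta_{k,k+\ell}(M)=0$ for every pair $(k,\ell)\ne(i,j)$ with $k\ge i$ and $\ell\ge j$. A sequence of (non-constant) monomials is regular on $R$ if and only if the monomials have pairwise disjoint supports. *)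

(* Defs.v *)
From Stdlib Require Import ClassicalEpsilon.
From mathcomp Require Import all_boot all_order all_algebra.
From mathcomp Require Import mpoly.

Set Implicit Arguments.
Unset Strict Implicit.
Unset Printing Implicit Defensive.

Import GRing.Theory Num.Theory.
Local Open Scope ring_scope.

(* Ideals of R = K[x_1..x_n] are Prop-valued subsets of {mpoly K[n]}:
   membership is not decidable a priori. *)

Definition ideal_gen (n : nat) (K : fieldType) (J : finType) (A : pred J)
    (g : J -> {mpoly K[n]}) (p : {mpoly K[n]}) : Prop :=
  exists c : J -> {mpoly K[n]}, p = \sum_(j | A j) c j * g j.

Definition colon (n : nat) (K : fieldType) (I : {mpoly K[n]} -> Prop)
    (g p : {mpoly K[n]}) : Prop := I (p * g).

Definition min_generates (n : nat) (K : fieldType) (J : finType)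
    (g : J -> {mpoly K[n]}) (I : {mpoly K[n]} -> Prop) : Prop :=
  (forall p, I p <-> ideal_gen xpredT g p) /\
  (forall A : {set J}, A \proper [set: J] ->
     ~ (forall p, I p <-> ideal_gen (mem A) g p)).

(* g 0, ..., g (r-1) is a regular sequence on R: each g i is a nonzerodivisor
   modulo the previous ones, and R / (g) is nonzero. *)
Definition regular_seq (n : nat) (K : fieldType) (r : nat)
    (g : 'I_r -> {mpoly K[n]}) : Prop :=
  (forall (i : 'I_r) (p : {mpoly K[n]}),
     ideal_gen (fun j : 'I_r => (j < i)%N) g (p * g i) ->
     ideal_gen (fun j : 'I_r => (j < i)%N) g p) /\
  ~ ideal_gen xpredT g 1.

(* Homogeneous of degree z : int; R has no nonzero element of negative
   degree. *)
Definition zhomog (n : nat) (K : fieldType) (z : int) (p : {mpoly K[n]}) : bool :=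
  match z with
  | Posz d => p \is d.-homog
  | Negz _ => p == 0
  end.

(* Sequence ... -> F_1 -> F_0 -> R of graded free modules of finite rank, where
   F_i = (+)_a R(- fshift i a).  Elements of F_i are row vectors and the maps
   act by right multiplication; fdiff i : F_(i+1) -> F_i, faug : F_0 -> R. *)
Record free_seq (n : nat) (K : fieldType) := FreeSeq {
  frank : nat -> nat;
  fshift : forall i, 'I_(frank i) -> int;
  fdiff : forall i, 'M[{mpoly K[n]}]_(frank i.+1, frank i);
  faug : 'cV[{mpoly K[n]}]_(frank 0)
}.

Definition graded_resolution (n : nat) (K : fieldType)
    (I : {mpoly K[n]} -> Prop) (F : free_seq n K) : Prop :=
  [/\ forall i a b, zhomog (fshift a - fshift b) (fdiff F i a b),
      forall a, zhomog (fshift a) (faug F a 0),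
      forall p, I p <-> exists v : 'rV_(frank F 0), p = (v *m faug F) 0 0,
      forall v : 'rV_(frank F 0),
        v *m faug F = 0 <-> exists w, v = w *m fdiff F 0
    & forall i (v : 'rV_(frank F i.+1)),
        v *m fdiff F i = 0 <-> exists w, v = w *m fdiff F i.+1].

Section Tor.
Variables (n : nat) (K : fieldType) (F : free_seq n K).

(* F (x)_R K with K = R / (x_1..x_n): the matrices of constant terms. *)
Definition kdiff i : 'M[K]_(frank F i.+1, frank F i) :=
  map_mx (mcoeff 0%MM) (fdiff F i).

Definition kcycles i : 'M[K]_(frank F i) :=
  match i return 'M[K]_(frank F i) with
  | 0 => 1%:M
  | i'.+1 => kermx (kdiff i')
  end.

(* Row space: the degree j part of F_i (x) K. *)
Definition kdegree i (j : int) : 'M[K]_(frank F i) :=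
  diag_mx (\row_a (fshift a == j)%:R).

(* dim_K H_i(F (x) K)_j. *)
Definition tor_dim i (j : int) : nat :=
  (\rank (kcycles i :&: kdegree i j) - \rank (kdiff i :&: kdegree i j))%N.

End Tor.

(* Tor is computed from a chosen graded free resolution of I; every choice
   gives the same value. *)
Definition betti (n : nat) (K : fieldType) (I : {mpoly K[n]} -> Prop)
    (i : nat) (j : int) : nat :=
  tor_dim (epsilon (inhabits (FreeSeq (fun i (a : 'I_0) => 0) (fun=> 0) 0))
             (graded_resolution I)) i j.

Definition is_reg (n : nat) (K : fieldType) (I : {mpoly K[n]} -> Prop)
    (r : int) : Prop :=
  (exists i j, betti I i j <> 0%N /\ r = j - i%:Z) /\
  (forall i j, betti I i j <> 0%N -> j - i%:Z <= r).

Definition is_pdim (n : nat) (K : fieldType) (I : {mpoly K[n]} -> Prop)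
    (p : nat) : Prop :=
  (exists j, betti I p j <> 0%N) /\
  (forall i j, betti I i j <> 0%N -> (i <= p)%N).

(* Extremality of betti_(i,i+j). *)
Definition extremal (n : nat) (K : fieldType) (I : {mpoly K[n]} -> Prop)
    (i : nat) (j : int) : Prop :=
  betti I i (i%:Z + j) <> 0%N /\
  (forall (k : nat) (l : int), (k, l) <> (i, j) -> (i <= k)%N -> j <= l ->
     betti I k (k%:Z + l) = 0%N).

Definition has_dim (K : fieldType) (V : lmodType K) (A : V -> Prop) (d : nat) :=
  exists e : 'I_d -> V,
    (forall v, A v <-> exists c : 'I_d -> K, v = \sum_a c a *: e a) /\
    (forall c : 'I_d -> K, \sum_a c a *: e a = 0 -> forall a, c a = 0).

Definition dim (K : fieldType) (V : lmodType K) (A : V -> Prop) : nat :=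
  epsilon (inhabits 0%N) (has_dim A).

Definition hilbert_fun (n : nat) (K : fieldType) (I : {mpoly K[n]} -> Prop)
    (d : nat) : nat :=
  dim (fun p : {mpoly K[n]} => I p /\ p \is d.-homog).

(* N = (1 - t)^n HS(I, t), compared coefficientwise as power series; HS has no
   terms of negative degree since I is contained in R. *)
Definition is_hilbert_numerator (n : nat) (K : fieldType)
    (I : {mpoly K[n]} -> Prop) (N : {poly int}) : Prop :=
  forall k : nat, N`_k =
    \sum_(i < k.+1) ((1 - 'X) ^+ n : {poly int})`_i
                    * (hilbert_fun I (k - i))%:Z.

Definition hilbert_numerator (n : nat) (K : fieldType)
    (I : {mpoly K[n]} -> Prop) : {poly int} :=
  epsilon (inhabits 0) (is_hilbert_numerator I).

Definition hilbert_deg (n : nat) (K : fieldType)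
    (I : {mpoly K[n]} -> Prop) : nat := (size (hilbert_numerator I)).-1.

(* Generators are indexed from 0, so the first one is excluded by 0 < k. *)

Definition Pmax (m : nat) (r : 'I_m -> nat) : nat :=
  \max_(k < m | (0 < k)%N) r k.

(* The truncated subtraction is exact: the members of a regular sequence of
   monomials have degree at least 1. *)
Definition Qmax (n m : nat) (f : 'I_m -> 'X_{1..n}) (r : 'I_m -> nat)
    (alpha : forall k, 'I_(r k) -> 'X_{1..n}) : nat :=
  \max_(k < m | (0 < k)%N)
    (mdeg (f k) + \sum_(i < r k) mdeg (alpha k i) - r k)%N.

(* Main.v *)
From HB Require Import structures.
From Stdlib Require Import ClassicalEpsilon FunctionalExtensionality.
From Stdlib Require Import PropExtensionality.
Require Import Defs.
From mathcomp Require Import all_boot all_order all_algebra.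
From mathcomp Require Import mpoly zify.

Set Implicit Arguments.
Unset Strict Implicit.
Unset Printing Implicit Defensive.

Import GRing.Theory Num.Theory.
Local Open Scope ring_scope.

(** Write [I_k] for the ideal generated by the first [k] monomials.  Adding one
    generator [g] of degree [d] to an ideal [I] is controlled by the exact
    sequence [0 -> I -> I + (g) -> (R / (I : g))(-d) -> 0].  Two consequences
    drive the proof.

    First, the mapping cone of a lift of multiplication by [g] turns graded free
    resolutions of [I] and of [I : g] into one of [I + (g)]
    ([cone_resolution]).  When [g] is regular modulo [I], the colon ideal is [I]
    itself, so iterating the cone along a regular sequence yields its Koszul
    resolution ([resolved_regular]); iterating it along the monomials [f_k],
    whose colon ideals are generated by regular sequences, yields a finite
    resolution [G] of the given ideal.  Reading off the degrees, the generators
    of [G] in homological degree [i] have degree [j] with [i <= P] and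
    [j - i <= Q].  Only the degree of the first monomial is not obviously
    bounded by [Q]; there minimality of the generators enters
    ([first_colon_bounds]).

    Second, the numerators [N] of the Hilbert series satisfy
    [N(I + (g)) = N(I) + t^d (1 - N(I : g))], which is also how the generators
    of the cone are counted.  Hence every monomial [t^j] occurring in the
    numerator is the degree of some generator of [G] ([resolved_add]).

    Now let [P + Q] be the degree of the numerator.  Then [G] has a generator of
    degree [P + Q], and the two bounds force every such generator into
    homological degree [P].  In that degree [G] modulo the variables has no
    differential, so the Betti number at [(P, P + Q)] is nonzero
    ([tor_dim_concentrated]), while all nonzero Betti numbers obey the two
    bounds; the four claims follow by arithmetic.

    Betti numbers refer to an arbitrarily chosen resolution, so the argument
    also needs that the vanishing of Tor does not depend on the choice
    ([tor_dim_transfer]): any two resolutions are compared by chain maps that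
    are inverse up to homotopy. *)

(** * Homogeneous components and graded matrices *)

Section Homogeneous.
Variables (n : nat) (K : fieldType).
Implicit Types (p q : {mpoly K[n]}) (z : int).

Lemma zhomog0 z : zhomog z (0 : {mpoly K[n]}).
Proof. by case: z => [d|d] /=; rewrite ?dhomog0. Qed.

Lemma zhomogD z p q : zhomog z p -> zhomog z q -> zhomog z (p + q).
Proof.
case: z => [d|d] /=; first exact: dhomogD.
by move=> /eqP-> /eqP->; rewrite addr0.
Qed.

Lemma zhomogN z p : zhomog z p -> zhomog z (- p).
Proof. by case: z => [d|d] /=; rewrite ?dhomogN // oppr_eq0. Qed.

Lemma zhomogM z w p q : zhomog z p -> zhomog w q -> zhomog (z + w) (p * q).
Proof.
case: z => [d|d] /=; last by move=> /eqP-> _; rewrite mul0r zhomog0.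
case: w => [e|e] /=; last by move=> _ /eqP->; rewrite mulr0 zhomog0.
exact: dhomogM.
Qed.

Lemma zhomog_sum z (J : finType) (F : J -> {mpoly K[n]}) :
  (forall j, zhomog z (F j)) -> zhomog z (\sum_j F j).
Proof.
move=> hF; elim/big_rec: _ => [|j p _ hp]; [exact: zhomog0|exact: zhomogD].
Qed.

Lemma zhomog1 : zhomog 0 (1 : {mpoly K[n]}).
Proof. exact: dhomog1. Qed.

Lemma zhomog_const z p : zhomog z p -> z != 0 -> p@_0%MM = 0.
Proof.
case: z => [d|d] /=; last by move=> /eqP->; rewrite mcoeff0.
move=> hp dn0; apply: (dhomog_nemf_coeff hp); rewrite /= mdeg0 eq_sym.
by apply: contraNneq dn0 => ->.
Qed.

Definition homog_part z p := if z is Posz d then pihomog mdeg d p else 0.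

Lemma homog_partP z p : zhomog z (homog_part z p).
Proof. by case: z => [d|d] /=; rewrite ?pihomogP. Qed.

Lemma homog_part_id z p : zhomog z p -> homog_part z p = p.
Proof. by case: z => [d|d] /=; [exact: pihomog_dE | move=> /eqP->]. Qed.

Lemma homog_part_ne z w p : zhomog w p -> w != z -> homog_part z p = 0.
Proof.
case: z => [d|d] //=; case: w => [e|e] /=; last first.
  by move=> /eqP->; rewrite pihomog0.
by move=> hp ne; apply: (pihomog_ne0 _ hp); apply: contraNneq ne => ->.
Qed.

Lemma homog_part_sum z (J : finType) (F : J -> {mpoly K[n]}) :
  homog_part z (\sum_j F j) = \sum_j homog_part z (F j).
Proof. by case: z => [d|d] /=; [rewrite raddf_sum | rewrite big1]. Qed.

(** Splitting [p] into its homogeneous components, only the one of degree [z]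
    contributes to degree [z + w].  For negative [z] this includes the fact that
    [p * q] has no component in degree below [w]. *)
Lemma homog_partM z w p q :
  zhomog w q -> homog_part (z + w) (p * q) = homog_part z p * q.
Proof.
move=> hq; have pE := pihomog_partitionE (leqnn (mmeasure mdeg p)).
rewrite {1}pE mulr_suml homog_part_sum.
have part (d : 'I_(mmeasure mdeg p)) :
    homog_part (z + w) (pihomog mdeg d p * q) =
    homog_part z (pihomog mdeg d p) * q.
  have hd : zhomog (Posz d) (pihomog mdeg d p) by exact: pihomogP.
  have [<-|ne] := eqVneq (Posz d) z.
    by rewrite !homog_part_id //; apply: zhomogM.
  rewrite (homog_part_ne (zhomogM hd hq)) 1?(homog_part_ne hd) ?mul0r //.
  by rewrite (inj_eq (addIr w)).
under eq_bigr do rewrite part.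
by rewrite -mulr_suml -homog_part_sum -pE.
Qed.

(** Matrices of degree-preserving maps between graded free modules whose
    generators have the degrees [s] and [t]. *)
Definition graded_mx k l (s : 'I_k -> int) (t : 'I_l -> int)
  (A : 'M[{mpoly K[n]}]_(k, l)) := forall a b, zhomog (s a - t b) (A a b).

Lemma graded_mx0 k l (s : 'I_k -> int) (t : 'I_l -> int) : graded_mx s t 0.
Proof. by move=> a b; rewrite mxE zhomog0. Qed.

Lemma graded_mxD k l (s : 'I_k -> int) (t : 'I_l -> int) A B :
  graded_mx s t A -> graded_mx s t B -> graded_mx s t (A + B).
Proof. by move=> hA hB a b; rewrite mxE zhomogD. Qed.

Lemma graded_mxN k l (s : 'I_k -> int) (t : 'I_l -> int) A :
  graded_mx s t A -> graded_mx s t (- A).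
Proof. by move=> hA a b; rewrite mxE zhomogN. Qed.

Lemma graded_mxM k l m (s : 'I_k -> int) (t : 'I_l -> int) (u : 'I_m -> int) A B :
  graded_mx s t A -> graded_mx t u B -> graded_mx s u (A *m B).
Proof.
move=> hA hB a b; rewrite mxE; apply: zhomog_sum => c.
by rewrite -(subrKA (t c)) zhomogM.
Qed.

Lemma graded_mx_scalar k (s : 'I_k -> int) z p :
  zhomog z p -> graded_mx (fun a => s a + z) s p%:M.
Proof.
move=> hp a b; rewrite mxE; case: eqP => [->|_]; last exact: zhomog0.
by rewrite mulr1n addrC addrA addNr add0r.
Qed.

(** Any factorization of a graded matrix through a graded matrix can be made
    graded: keep from each entry of the other factor the component of the
    right degree. *)
Lemma graded_mx_lift k l m (s : 'I_k -> int) (t : 'I_l -> int) (u : 'I_m -> int)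
    (A : 'M_(k, m)) (D : 'M_(l, m)) :
  graded_mx s u A -> graded_mx t u D -> (forall a, exists w, row a A = w *m D) ->
  exists2 B, graded_mx s t B & A = B *m D.
Proof.
move=> hA hD rowA.
have [W AE] : exists W, A = W *m D.
  pose w a := proj1_sig (constructive_indefinite_description _ (rowA a)).
  exists (\matrix_a w a); apply/row_matrixP => a; rewrite row_mul rowK /w.
  by case: constructive_indefinite_description.
exists (\matrix_(a, c) homog_part (s a - t c) (W a c)).
  by move=> a c; rewrite mxE homog_partP.
apply/matrixP => a b; rewrite -(homog_part_id (hA a b)) {1}AE !mxE homog_part_sum.
by apply: eq_bigr => c _; rewrite mxE -(homog_partM _ _ (hD c b)) subrKA.
Qed.

(** The matrix of the map induced modulo the ideal of the variables. *)
Definition residue_mx k l (A : 'M[{mpoly K[n]}]_(k, l)) : 'M[K]_(k, l) :=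
  map_mx (mcoeff 0%MM) A.

Lemma residue_mxM k l m (A : 'M_(k, l)) (B : 'M_(l, m)) :
  residue_mx (A *m B) = residue_mx A *m residue_mx B.
Proof. exact: map_mxM. Qed.

Lemma residue_mxD k l (A B : 'M_(k, l)) : residue_mx (A + B) = residue_mx A + residue_mx B.
Proof. exact: map_mxD. Qed.

Lemma residue_mxB k l (A B : 'M_(k, l)) : residue_mx (A - B) = residue_mx A - residue_mx B.
Proof. exact: map_mxB. Qed.

Lemma residue_mx1 k : residue_mx (1%:M : 'M_k) = 1%:M.
Proof. exact: map_mx1. Qed.

(** Modulo the variables only entries between generators of equal degree
    survive. *)
Lemma residue_mx_eq0 k l (s : 'I_k -> int) (t : 'I_l -> int) A a b :
  graded_mx s t A -> s a != t b -> residue_mx A a b = 0.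
Proof.
by move=> hA ne; rewrite mxE (zhomog_const (hA a b)) // subr_eq0.
Qed.

End Homogeneous.

(** * Comparison of resolutions *)

(** The form of dependent choice that builds chain maps and homotopies one
    homological degree at a time: [P] is the invariant that makes the next step
    possible, [R] the equation linking consecutive terms. *)
Lemma dependent_choice (T : nat -> Type) (P : forall i, T i -> Prop)
    (R : forall i, T i -> T i.+1 -> Prop) (x0 : T 0) :
  P 0 x0 -> (forall i x, P i x -> exists2 y, P i.+1 y & R i x y) ->
  exists x : forall i, T i, [/\ x 0 = x0, forall i, P i (x i)
    & forall i, R i (x i) (x i.+1)].
Proof.
move=> P0 step.
have nxt i (x : {x : T i | P i x}) : {y : T i.+1 | P i.+1 y /\ R i (sval x) y}.
  apply: constructive_indefinite_description.
  by have [y Py Ry] := step i _ (svalP x); exists y.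
pose f := nat_rect (fun i => {x : T i | P i x}) (exist _ x0 P0)
  (fun i x => exist _ (sval (nxt i x)) (proj1 (svalP (nxt i x)))).
exists (fun i => sval (f i)); split=> // i; first exact: svalP.
exact: (proj2 (svalP (nxt i (f i)))).
Qed.

Section Augmented.
Variables (n : nat) (K : fieldType).
Implicit Types (I J : {mpoly K[n]} -> Prop) (F G : free_seq n K).

(** The resolution augmented by [R], placed in index 0 with its generator in
    degree 0; index [i.+1] carries the i-th free module.  Lifting starts from a
    map of the rings in index 0, and no separate first step is needed. *)
Definition aug_rank F i := if i is i'.+1 then frank F i' else 1.

Definition aug_shift F i : 'I_(aug_rank F i) -> int :=
  match i return 'I_(aug_rank F i) -> int with
  | 0 => fun=> 0
  | i'.+1 => @fshift n K F i'
  end.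

Definition aug_diff F i : 'M[{mpoly K[n]}]_(aug_rank F i.+1, aug_rank F i) :=
  match i return 'M_(aug_rank F i.+1, aug_rank F i) with
  | 0 => faug F
  | i'.+1 => fdiff F i'
  end.

Lemma aug_diff_graded I F i : graded_resolution I F ->
  graded_mx (@aug_shift F i.+1) (@aug_shift F i) (aug_diff F i).
Proof.
case=> hd ha _ _ _; case: i => [|i] a b /=; last exact: hd.
by rewrite subr0 (ord1 b); apply: ha.
Qed.

Lemma aug_diff_exact I F i (v : 'rV_(aug_rank F i.+1)) : graded_resolution I F ->
  v *m aug_diff F i = 0 <-> exists w, v = w *m aug_diff F i.+1.
Proof. by case=> _ _ _ h0 h1; case: i v => [|i] v; [apply: h0|apply: h1]. Qed.

Lemma aug_diff_image I F (v : 'rV_1) : graded_resolution I F ->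
  I (v 0 0) <-> exists w, v = w *m aug_diff F 0.
Proof.
case=> _ _ hI _ _; rewrite hI; split=> -[w wE]; exists w; last by rewrite wE.
by apply/matrixP => a b; rewrite !ord1 wE.
Qed.

Lemma aug_diff_mul I F i k (A : 'M_(k, _)) : graded_resolution I F ->
  A *m aug_diff F i.+1 *m aug_diff F i = 0.
Proof.
move=> resF; apply/row_matrixP => a; rewrite -mulmxA row_mul row0 mulmxA.
by apply/(aug_diff_exact _ resF); exists (row a A).
Qed.

Lemma aug_diff_lift I F i k (s : 'I_k -> int) (A : 'M_(k, _)) :
  graded_resolution I F -> graded_mx s (@aug_shift F i.+1) A -> A *m aug_diff F i = 0 ->
  exists2 B, graded_mx s (@aug_shift F i.+2) B & A = B *m aug_diff F i.+1.
Proof.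
move=> resF hA A0; apply: (graded_mx_lift hA (aug_diff_graded resF)) => a.
by apply/(aug_diff_exact _ resF); rewrite -row_mul A0 row0.
Qed.

(** Multiplication by [g] of degree [z] from [I] to [J] lifts to a chain map that
    raises degrees by [z].  With [g = 1] this compares two resolutions of one
    ideal; with [I] the colon ideal of [J] by [g] it is the map whose cone
    resolves [J + (g)]. *)
Lemma chain_lift I J F G (z : int) (g : {mpoly K[n]}) :
    graded_resolution I F -> graded_resolution J G -> zhomog z g ->
    (forall p, I p -> J (p * g)) ->
  exists phi : forall i, 'M_(aug_rank F i, aug_rank G i),
    [/\ phi 0 = g%:M,
        forall i, graded_mx (fun a => @aug_shift F i a + z) (@aug_shift G i) (phi i)
      & forall i, phi i.+1 *m aug_diff G i = aug_diff F i *m phi i].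
Proof.
move=> resF resG hg IJ.
pose P i (x : 'M_(aug_rank F i, aug_rank G i)) :=
  graded_mx (fun a => @aug_shift F i a + z) (@aug_shift G i) x /\
  forall a, exists w, row a (aug_diff F i *m x) = w *m aug_diff G i.
pose R i (x : 'M_(aug_rank F i, aug_rank G i))
    (y : 'M_(aug_rank F i.+1, aug_rank G i.+1)) :=
  y *m aug_diff G i = aug_diff F i *m x.
have P0 : P 0 g%:M.
  split=> [|a]; first exact: (@graded_mx_scalar n K 1).
  apply/(aug_diff_image _ resG); rewrite mul_mx_scalar !mxE mulrC; apply: IJ.
  have -> : aug_diff F 0 a 0 = row a (aug_diff F 0) 0 0 by rewrite mxE.
  by apply/(aug_diff_image _ resF); exists (delta_mx 0 a); rewrite -rowE.
have step i x : P i x -> exists2 y, P i.+1 y & R i x y.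
  case=> hx imx.
  have hA : graded_mx (fun a => @aug_shift F i.+1 a + z) (@aug_shift G i)
                      (aug_diff F i *m x).
    apply: (graded_mxM (t := fun a => @aug_shift F i a + z)) hx => a b.
    by rewrite [X in _ - X]addrC addrKA; apply: (aug_diff_graded resF).
  have [y hy yE] := graded_mx_lift hA (aug_diff_graded resG) imx.
  exists y => //; split=> // a; apply/(aug_diff_exact _ resG).
  rewrite row_mul -mulmxA -yE !mulmxA -row_mul.
  by rewrite -[aug_diff F i.+1]mul1mx (aug_diff_mul _ resF) row0 mul0mx.
have [phi [phi0 Pphi Rphi]] := dependent_choice P0 step.
by exists phi; split=> // i; case: (Pphi i).
Qed.

(** A chain endomorphism vanishing in index 0 is homotopic to zero, with a
    homotopy that also vanishes there; the latter removes the augmentation from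
    the homotopy formula modulo the variables. *)
Lemma null_homotopy I F (theta : forall i, 'M_(aug_rank F i)) :
    graded_resolution I F -> theta 0 = 0 ->
    (forall i, graded_mx (@aug_shift F i) (@aug_shift F i) (theta i)) ->
    (forall i, theta i.+1 *m aug_diff F i = aug_diff F i *m theta i) ->
  exists h : forall i, 'M_(aug_rank F i, aug_rank F i.+1),
    h 0 = 0 /\
    forall i, theta i.+1 = aug_diff F i *m h i + h i.+1 *m aug_diff F i.+1.
Proof.
move=> resF theta0 htheta cth.
pose T i := 'M[{mpoly K[n]}]_(aug_rank F i, aug_rank F i.+1).
pose P i (h : T i) :=
  graded_mx (@aug_shift F i) (@aug_shift F i.+1) h /\
  (theta i.+1 - aug_diff F i *m h) *m aug_diff F i = 0.
pose R i (h : T i) (h' : T i.+1) :=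
  theta i.+1 = aug_diff F i *m h + h' *m aug_diff F i.+1.
have P0 : P 0 0.
  by split; [exact: graded_mx0 | rewrite mulmx0 subr0 cth theta0 mulmx0].
have step i h : P i h -> exists2 h', P i.+1 h' & R i h h'.
  case=> hh h0.
  have hA : graded_mx (@aug_shift F i.+1) (@aug_shift F i.+1)
                      (theta i.+1 - aug_diff F i *m h).
    by apply/graded_mxD/graded_mxN/(graded_mxM (aug_diff_graded resF) hh).
  have [h' hh' h'E] := aug_diff_lift resF hA h0.
  exists h'; last by rewrite /R -h'E addrC subrK.
  split=> //; rewrite mulmxBl cth -mulmxA -h'E mulmxBr !mulmxA.
  have := aug_diff_mul (i := i) 1%:M resF; rewrite mul1mx => ->.
  by rewrite mul0mx subr0 subrr.
have [h [h0 _ Rh]] := dependent_choice P0 step.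
by exists h.
Qed.

End Augmented.

Section Tor.
Variables (n : nat) (K : fieldType).
Implicit Types (I : {mpoly K[n]} -> Prop) (F G : free_seq n K).

(** The differential leaving the i-th term modulo the variables.  It is zero for
    [i = 0], where the augmentation is not part of the complex computing Tor. *)
Definition kdiff_from F i : 'M[K]_(frank F i, aug_rank F i) :=
  if i is 0 then 0 else residue_mx (aug_diff F i).

Lemma sub_kcycles F i (v : 'rV_(frank F i)) :
  (v <= kcycles F i)%MS = (v *m kdiff_from F i == 0).
Proof.
case: i v => [|i] v /=; first by rewrite submx1 mulmx0 eqxx.
by apply/sub_kermxP/eqP.
Qed.

Lemma sub_kdegree F i (j : int) (v : 'rV_(frank F i)) :
  (v <= kdegree F i j)%MS <-> forall a, fshift a != j -> v 0 a = 0.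
Proof.
split=> [/submxP[w ->] a ne|v0].
  by rewrite /kdegree mul_mx_diag !mxE (negbTE ne) mulr0.
apply/submxP; exists v; rewrite /kdegree mul_mx_diag; apply/rowP => a.
rewrite !mxE; have [//|ne] := eqVneq; first by rewrite mulr1.
by rewrite v0 ?mul0r.
Qed.

(** Boundaries are cycles, so the truncated difference of ranks in [tor_dim]
    vanishes exactly when every cycle of degree [j] is a boundary. *)
Lemma tor_dim_eq0 I F i j : graded_resolution I F ->
  tor_dim F i j = 0%N <->
  forall v : 'rV_(frank F i), v *m kdiff_from F i = 0 ->
    (forall a, fshift a != j -> v 0 a = 0) -> (v <= kdiff F i)%MS.
Proof.
move=> resF.
have BZ : (kdiff F i <= kcycles F i)%MS.
  apply/row_subP => a; rewrite sub_kcycles -row_mul.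
  suff -> : kdiff F i *m kdiff_from F i = 0 by rewrite row0.
  case: i a => [|i] a; first by rewrite mulmx0.
  have := aug_diff_mul (i := i.+1) 1%:M resF; rewrite mul1mx => /(congr1 (@residue_mx _ _ _ _)).
  by rewrite residue_mxM => ->; rewrite /residue_mx map_mx0.
have BEZE : (kdiff F i :&: kdegree F i j <= kcycles F i :&: kdegree F i j)%MS.
  exact: capmxS.
rewrite /tor_dim; split=> [d0 v vZ vE|ZB].
  have /andP[_ ZEBE] : (kdiff F i :&: kdegree F i j
      == kcycles F i :&: kdegree F i j)%MS.
    by rewrite -(geq_leqif (mxrank_leqif_eq BEZE)) -subn_eq0 d0.
  apply: submx_trans (submx_trans ZEBE (capmxSl _ _)).
  by rewrite sub_capmx sub_kcycles vZ eqxx; apply/sub_kdegree.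
apply/eqP; rewrite subn_eq0; apply: mxrankS; apply/row_subP => a.
have := row_sub a (kcycles F i :&: kdegree F i j)%MS; rewrite !sub_capmx.
case/andP => vZ vE; rewrite vE andbT; apply: ZB; last exact/sub_kdegree.
by apply/eqP; rewrite -sub_kcycles.
Qed.

(** The identity of the homology of [F] factors through that of [G], because the
    composite of the comparison maps [F -> G -> F] is homotopic to the
    identity. *)
Lemma tor_dim_transfer I F G i j :
    graded_resolution I F -> graded_resolution I G ->
  tor_dim G i j = 0%N -> tor_dim F i j = 0%N.
Proof.
move=> resF resG /(tor_dim_eq0 _ _ resG) G0; apply/(tor_dim_eq0 _ _ resF) => v vZ vE.
have lift A B (resA : graded_resolution I A) (resB : graded_resolution I B) :
  exists phi : forall i, 'M[{mpoly K[n]}]_(aug_rank A i, aug_rank B i),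
    [/\ phi 0 = 1%:M,
        forall i, graded_mx (@aug_shift n K A i) (@aug_shift n K B i) (phi i)
      & forall i, phi i.+1 *m aug_diff B i = aug_diff A i *m phi i].
  have I1 p : I p -> I (p * 1) by rewrite mulr1.
  have [phi [phi0 hphi cphi]] := chain_lift resA resB (zhomog1 n K) I1.
  by exists phi; split=> // i' a b; have := hphi i' a b; rewrite addr0.
have [phi [phi0 hphi cphi]] := lift F G resF resG.
have [psi [psi0 hpsi cpsi]] := lift G F resG resF.
pose theta k := 1%:M - phi k *m psi k.
have theta0 : theta 0 = 0 by rewrite /theta phi0 psi0 mulmx1 subrr.
have htheta k : graded_mx (@aug_shift n K F k) (@aug_shift n K F k) (theta k).
  apply/graded_mxD/graded_mxN/(graded_mxM (hphi k) (hpsi k)) => a b.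
  rewrite mxE; case: eqP => [->|_]; last exact: zhomog0.
  by rewrite subrr; exact: zhomog1.
have ctheta k : theta k.+1 *m aug_diff F k = aug_diff F k *m theta k.
  by rewrite mulmxBl mulmxBr mul1mx mulmx1 -mulmxA cpsi !mulmxA cphi.
have [h [h0 hE]] := null_homotopy resF theta0 htheta ctheta.
(* A cycle differs from its image under phi then psi by a boundary. *)
have vthetaE : v = v *m residue_mx (phi i.+1) *m residue_mx (psi i.+1)
                   + v *m residue_mx (h i.+1) *m kdiff F i.
  have -> : v *m residue_mx (h i.+1) *m kdiff F i = v *m residue_mx (theta i.+1).
    rewrite hE residue_mxD mulmxDr !residue_mxM !mulmxA.
    suff -> : v *m residue_mx (aug_diff F i) *m residue_mx (h i) = 0 by rewrite add0r.
    case: (i) v vZ {vE} => [|i'] v vZ.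
      by rewrite h0 /residue_mx map_mx0 mulmx0.
    by rewrite vZ mul0mx.
  by rewrite residue_mxB residue_mxM residue_mx1 mulmxBr mulmx1 mulmxA addrC subrK.
rewrite vthetaE; apply: addmx_sub (submxMl _ _).
have: (v *m residue_mx (phi i.+1) <= kdiff G i)%MS.
  apply: G0 => [|b ne].
    case: (i) v vZ {vE vthetaE} => [|i'] v vZ; first by rewrite mulmx0.
    by rewrite -mulmxA /= -residue_mxM cphi residue_mxM mulmxA vZ mul0mx.
  rewrite mxE big1 // => a _; have [sa|sa] := eqVneq (fshift a) j.
    by rewrite (residue_mx_eq0 (hphi i.+1)) ?mulr0 //= sa eq_sym.
  by rewrite vE // mul0r.
case/submxP => w ->; rewrite -mulmxA -[kdiff G i]/(residue_mx (aug_diff G i.+1)) -residue_mxM.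
by rewrite -cpsi residue_mxM mulmxA; apply: submxMl.
Qed.

Lemma tor_dim_shift I F i j :
  graded_resolution I F -> tor_dim F i j <> 0%N ->
  exists a : 'I_(frank F i), fshift a = j.
Proof.
move=> resF tor0; apply: NNPP => noa.
apply/tor0/(tor_dim_eq0 _ _ resF) => v _ v0.
suff -> : v = 0 by apply: sub0mx.
apply/rowP => a; rewrite mxE v0 //; apply/eqP => sa.
by apply: noa; exists a.
Qed.

(** If all generators of degree [j] sit in homological degree [i], the
    degree-[j] strand of the resolution modulo the variables is a complex with
    one nonzero term, so nothing can cancel there. *)
Lemma tor_dim_concentrated I F i j : graded_resolution I F ->
    (forall k (a : 'I_(frank F k)), fshift a = j -> k = i) ->
  tor_dim F i j = 0%N -> forall a : 'I_(frank F i), fshift a != j.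
Proof.
move=> resF conc /(tor_dim_eq0 _ _ resF) B0 a.
apply/eqP => sa.
have: ((delta_mx 0 a : 'rV_(frank F i)) <= kdiff F i)%MS.
  apply: B0 => [|b].
    apply/rowP => b; rewrite -rowE !mxE.
    case: (i) conc a sa b => [|i'] conc a sa b /=; first by rewrite mxE.
    rewrite (residue_mx_eq0 (aug_diff_graded (i := i'.+1) resF)) //=.
    by rewrite sa eq_sym; apply/eqP => /conc/esym/eqP; rewrite eqn_leq ltnn.
  rewrite mxE eqxx /=; case: (eqVneq b a) => // ->; rewrite sa eqxx //.
case/submxP => w /rowP/(_ a); rewrite !mxE !eqxx /= big1 => [/eqP|c _].
  by rewrite oner_eq0.
rewrite -[kdiff F i]/(residue_mx (aug_diff F i.+1)).
rewrite (residue_mx_eq0 (aug_diff_graded resF)) ?mulr0 //=.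
by rewrite sa; apply/eqP => /conc/eqP; rewrite eqn_leq ltnn.
Qed.

(** The chosen resolution is a resolution because [G] witnesses that there is
    one, so any convenient [G] decides which Betti numbers vanish. *)
Lemma betti_resolution I G : graded_resolution I G ->
  forall i j, betti I i j = 0%N <-> tor_dim G i j = 0%N.
Proof.
move=> resG i j; rewrite /betti.
set F := epsilon _ _; have resF : graded_resolution I F.
  by apply: epsilon_spec; exists G.
split; [exact: (tor_dim_transfer resG resF) | exact: (tor_dim_transfer resF resG)].
Qed.

End Tor.

(** * The mapping cone *)

Section Cone.
Variables (n : nat) (K : fieldType).
Implicit Types (I : {mpoly K[n]} -> Prop) (F H : free_seq n K).

Definition ideal_add I (g p : {mpoly K[n]}) : Prop :=
  exists2 q, I q & exists c, p = q + c * g.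

(** The cone of [tau] between the augmented complexes, of which index 0 keeps
    only the [R] of [F].  As [H] enters with its augmentation, its [R(-d)] lands
    in homological degree 0, where it maps onto the new generator. *)
Definition cone (d : int) F H
    (tau : forall i, 'M[{mpoly K[n]}]_(aug_rank H i, aug_rank F i)) : free_seq n K :=
  @FreeSeq n K (fun i => frank F i + aug_rank H i)%N
    (fun i a => match split a with
                | inl b => fshift b
                | inr b => aug_shift b + d
                end)
    (fun i => block_mx (fdiff F i) 0 (tau i.+1) (- aug_diff H i))
    (col_mx (faug F) (tau 0)).

(** Exactness is a diagram chase: if [(u, v)] is a cycle, [v] is a cycle of the
    augmented [H] (in degree 0: [v * g] is in [I], so [v] is in the colon ideal),
    hence a boundary, and subtracting the corresponding boundary of the cone
    leaves a cycle of [F]. *)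
Lemma cone_resolution I F H (d : int) (g : {mpoly K[n]}) :
    zhomog d g -> graded_resolution I F -> graded_resolution (colon I g) H ->
  exists tau : forall i, 'M_(aug_rank H i, aug_rank F i),
    graded_resolution (ideal_add I g) (cone d tau).
Proof.
move=> hg resF resH.
have [tau [tau0 htau ctau]] := chain_lift resH resF hg (fun p Ip => Ip).
exists tau; case: (resF) => hd ha hI ex0 ex1.
have cone_sq i (w : 'rV_(frank F i.+1)) (x : 'rV_(aug_rank H i.+1)) :
    w *m fdiff F i *m aug_diff F i + x *m tau i.+1 *m aug_diff F i
      - x *m aug_diff H i *m tau i = 0.
  by rewrite (aug_diff_mul (i := i) w resF) add0r -!mulmxA ctau subrr.
(* In degree 0 the condition on v is membership in the colon ideal, afterwards
   it is the vanishing of its differential. *)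
have kerH i (v : 'rV_(aug_rank H i)) :
    match i return 'rV_(aug_rank H i) -> Prop with
    | 0 => fun v => colon I g (v 0 0)
    | i'.+1 => fun v => v *m aug_diff H i' = 0
    end v -> exists w, v = w *m aug_diff H i.
  by case: i v => [|i] v; [move/(aug_diff_image _ resH) | move/(aug_diff_exact _ resH)].
have lift_cycle i (u : 'rV_(frank F i)) (v : 'rV_(aug_rank H i)) :
    u *m aug_diff F i + v *m tau i = 0 -> (exists w, v = w *m aug_diff H i) ->
    exists w x, u = w *m fdiff F i + x *m tau i.+1 /\ v = x *m - aug_diff H i.
  move=> uv0 [w vE].
  have : (u + w *m tau i.+1) *m aug_diff F i = 0.
    by rewrite mulmxDl -mulmxA ctau mulmxA -vE.
  case/(aug_diff_exact _ resF) => u' u'E; exists u', (- w); split.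
    by rewrite mulNmx -[X in X - _]u'E addrK.
  by rewrite mulNmx mulmxN opprK.
split.
- move=> i a b; rewrite /= /block_mx mxE /row_mx.
  case: (split a) => a'; rewrite mxE; case: (split b) => b'.
  + exact: hd.
  + by rewrite mxE zhomog0.
  + exact: htau.
  + rewrite mxE zhomogN // [X in _ - X]addrC addrKA.
    exact: (aug_diff_graded resH).
- move=> a /=; rewrite mxE; case: (split a) => a'; first exact: ha.
  by have := htau 0 a' 0; rewrite /= subr0.
- move=> p; split=> [[q Iq [c ->]]|[v ->]].
    have [u ->] := (hI q).1 Iq; exists (row_mx u c%:M).
    by rewrite mul_row_col tau0 mul_mx_scalar [RHS]mxE !mxE mulrC mulr1n.
  rewrite -[v]hsubmxK mul_row_col tau0 mul_mx_scalar.
  exists ((lsubmx v *m faug F) 0 0); first by apply/hI; exists (lsubmx v).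
  by exists (rsubmx v 0 0); rewrite mxE [in X in _ + X]mxE mulrC.
- move=> v; split=> [|[w ->]].
    rewrite -[v]hsubmxK mul_row_col; set u := lsubmx v; set x := rsubmx v => ux0.
    have [|w [y [uE xE]]] := lift_cycle 0 u x ux0.
      apply: kerH; change (I (x 0 0 * g)).
      have Ineg p : I p -> I (- p).
        move=> /hI[y ->]; apply/hI; exists (- y).
        by rewrite mulNmx [RHS]mxE.
      have <- : - (u *m faug F) 0 0 = x 0 0 * g.
        move: ux0; rewrite tau0 mul_mx_scalar => /matrixP/(_ 0 0).
        by rewrite !mxE mulrC => /eqP; rewrite addr_eq0 => /eqP ->; rewrite opprK.
      by apply: Ineg; apply/hI; exists u.
    by exists (row_mx w y); rewrite /= mul_row_block mulmx0 add0r -uE -xE.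
  rewrite -[w]hsubmxK /= mul_row_block mulmx0 add0r mul_row_col mulmxDl.
  by rewrite mulmxN mulNmx; apply: (cone_sq 0).
- move=> i v; split=> [|[w ->]].
    rewrite -[v]hsubmxK /= mul_row_block mulmx0 add0r.
    set u := lsubmx v; set x := rsubmx v => /eqP; rewrite -row_mx0.
    case/eqP/eq_row_mx => ux0 x0.
    have [|w [y [uE xE]]] := lift_cycle i.+1 u x ux0.
      by apply: kerH; apply/eqP; rewrite -oppr_eq0 -mulmxN x0.
    by exists (row_mx w y); rewrite mul_row_block mulmx0 add0r -uE -xE.
  rewrite -[w]hsubmxK /= !mul_row_block !mulmx0 !add0r mulmxDl.
  rewrite !mulmxN !mulNmx opprK (cone_sq i.+1) (aug_diff_mul (i := i) _ resH).
  exact: row_mx0.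
Qed.

Definition zero_seq : free_seq n K :=
  @FreeSeq n K (fun=> 0%N) (fun _ _ => 0) (fun=> 0) 0.

Lemma zero_resolution : graded_resolution (fun p => p = 0) zero_seq.
Proof.
split=> [i []//|[]//|p|v|i v].
- split=> [->|[v ->]]; last by rewrite mulmx0 mxE.
  by exists 0; rewrite mulmx0 mxE.
- by split=> _; [exists 0; rewrite mul0mx|]; rewrite [v]thinmx0 ?mul0mx.
- by split=> _; [exists 0; rewrite mul0mx|]; rewrite [v]thinmx0 ?mul0mx.
Qed.

End Cone.

(** * Dimensions of subspaces *)

Section Dimension.
Variables (K : fieldType) (V : lmodType K).
Implicit Types (A : V -> Prop).

Definition lcomb k (b : 'I_k -> V) (y : 'rV[K]_k) := \sum_j y 0 j *: b j.

Lemma lcombD k (b : 'I_k -> V) y z : lcomb b (y + z) = lcomb b y + lcomb b z.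
Proof.
by rewrite /lcomb -big_split; apply: eq_bigr => j _; rewrite mxE scalerDl.
Qed.

Lemma lcombN k (b : 'I_k -> V) y : lcomb b (- y) = - lcomb b y.
Proof. by rewrite /lcomb -sumrN; apply: eq_bigr => j _; rewrite mxE scaleNr. Qed.

Lemma lcomb_mul k l (b : 'I_l -> V) y (M : 'M_(k, l)) :
  lcomb b (y *m M) = lcomb (fun i => lcomb b (row i M)) y.
Proof.
rewrite /lcomb; under eq_bigr => j _ do rewrite mxE scaler_suml.
rewrite exchange_big; apply: eq_bigr => i _; rewrite scaler_sumr.
by apply: eq_bigr => j _; rewrite mxE scalerA.
Qed.

Lemma lcomb_row_mx k l (b : 'I_k -> V) (c : 'I_l -> V) y z :
  lcomb (fun i => match split i with inl j => b j | inr j => c j end)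
    (row_mx y z) = lcomb b y + lcomb c z.
Proof.
rewrite /lcomb big_split_ord; congr (_ + _); apply: eq_bigr => j _.
  by rewrite row_mxEl (unsplitK (inl j)).
by rewrite row_mxEr (unsplitK (inr j)).
Qed.

Lemma has_dimP A k : has_dim A k <-> exists b : 'I_k -> V,
  (forall v, A v <-> exists y, v = lcomb b y) /\
  (forall y, lcomb b y = 0 -> y = 0).
Proof.
split=> -[b [spanb freeb]]; exists b; split.
- move=> v; rewrite spanb; split=> [[c ->]|[y ->]].
    by exists (\row_j c j); apply: eq_bigr => j _; rewrite mxE.
  by exists (y 0).
- by move=> y /freeb y0; apply/rowP => j; rewrite y0 mxE.
- move=> v; rewrite spanb; split=> [[y ->]|[c ->]]; first by exists (y 0).
  by exists (\row_j c j); apply: eq_bigr => j _; rewrite mxE.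
- move=> c c0 j; have /rowP/(_ j) : \row_i c i = 0 :> 'rV_k.
    by apply: freeb; rewrite -{}c0; apply: eq_bigr => i _; rewrite mxE.
  by rewrite !mxE.
Qed.

Lemma row_free_ker k l (M : 'M[K]_(k, l)) :
  (forall y : 'rV_k, y *m M = 0 -> y = 0) -> row_free M.
Proof.
move=> M0; rewrite -kermx_eq0; apply/eqP/row_matrixP => i.
by rewrite row0; apply: M0; rewrite -row_mul mulmx_ker row0.
Qed.

(** Coordinates reduce statements on a finite-dimensional subspace of an
    arbitrary space to row spaces of matrices. *)
Lemma has_dim_basis_mx A k (l : nat) (b : 'I_l -> V) :
    has_dim A k -> (forall v, A v -> exists y, v = lcomb b y) ->
  exists2 M : 'M_(k, l), row_free M &
    forall v, A v <-> exists y, v = lcomb b (y *m M).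
Proof.
move=> /has_dimP[e [spane freee]] Ab.
have eb i : exists y, e i = lcomb b y.
  apply: Ab; apply/spane; exists (delta_mx 0 i).
  rewrite /lcomb (bigD1 i) //= mxE !eqxx scale1r big1 ?addr0 // => j /negbTE ji.
  by rewrite mxE ji andbF scale0r.
pose y i := proj1_sig (constructive_indefinite_description _ (eb i)).
have lcombM z : lcomb b (z *m \matrix_i y i) = lcomb e z.
  rewrite lcomb_mul; apply: eq_bigr => i _; rewrite rowK /y.
  by case: constructive_indefinite_description => /= ? <-.
exists (\matrix_i y i).
  apply: row_free_ker => z z0; apply: freee; rewrite -lcombM z0.
  by rewrite /lcomb big1 // => j _; rewrite mxE scale0r.
by move=> v; rewrite spane; split=> -[z ->]; exists z; rewrite lcombM.
Qed.

Lemma has_dim_le A B k l : has_dim A k -> has_dim B l ->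
  (forall v, A v -> B v) -> (k <= l)%N.
Proof.
move=> hA /has_dimP[b [spanb _]] AB.
have [v /AB/spanb //|M /eqP freeM _] := has_dim_basis_mx (b := b) hA.
by rewrite -freeM rank_leq_col.
Qed.

Lemma dim_eq A k : has_dim A k -> Defs.dim A = k.
Proof.
move=> hA; have hA' : has_dim A (Defs.dim A) by apply: epsilon_spec; exists k.
by apply/eqP; rewrite eqn_leq (has_dim_le hA hA') // (has_dim_le hA' hA).
Qed.

End Dimension.

(** [C = A + phi U], and [C / A] is isomorphic to [U / E] since [E] is the
    preimage of [A] in [U].  A basis of [C] consists of a basis of [A] and the
    image of a basis of a complement of [E] in [U]. *)
Lemma has_dim_add (K : fieldType) (V W : lmodType K) (phi : {linear W -> V})
    (A C : V -> Prop) (U E : W -> Prop) (a u e : nat) :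
    has_dim A a -> has_dim U u -> has_dim E e ->
    (forall w, E w <-> U w /\ A (phi w)) ->
    (forall v, C v <-> exists x w, [/\ A x, U w & v = x + phi w]) ->
  (e <= u)%N /\ has_dim C (a + (u - e))%N.
Proof.
move=> hA hU hE EUA CAU.
have EU w : E w -> U w by move/EUA => [].
split; first exact: has_dim_le hE hU EU.
have /has_dimP[bA [spanA freeA]] := hA.
have /has_dimP[bU [spanU freeU]] := hU.
have [w /EU/spanU //|M freeM spanE] := has_dim_basis_mx (b := bU) hE.
have phi_lcomb y : phi (lcomb bU y) = lcomb (fun j => phi (bU j)) y.
  by rewrite /lcomb linear_sum; apply: eq_bigr => j _; rewrite linearZ.
pose N := row_base (M^C)%MS.
have rN : \rank (M^C)%MS = (u - e)%N.
  by rewrite mxrank_compl (eqP freeM).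
rewrite -rN; apply/has_dimP.
exists (fun i => match split i with
  | inl j => bA j | inr j => phi (lcomb bU (row j N)) end).
have comb_N z : lcomb (fun j => phi (lcomb bU (row j N))) z
    = phi (lcomb bU (z *m N)).
  rewrite lcomb_mul /lcomb linear_sum.
  by apply: eq_bigr => j _; rewrite linearZ.
split=> [v|y].
  rewrite CAU; split=> [[x [w [/spanA[y ->] /spanU[z ->] ->]]]|[y ->]].
    have : (z <= M + N)%MS.
      rewrite (adds_eqmx (eqmx_refl M) (eq_row_base _)).
      exact: submx_full (addsmx_compl_full M).
    case/sub_addsmxP => -[z1 z2] /= ->.
    have /EUA[_ /spanA[y' y'E]] : E (lcomb bU (z1 *m M)).
      by apply/spanE; exists z1.
    exists (row_mx (y + y') z2).
    by rewrite lcomb_row_mx comb_N !lcombD raddfD /= y'E addrA.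
  rewrite -[y]hsubmxK lcomb_row_mx comb_N.
  exists (lcomb bA (lsubmx y)), (lcomb bU (rsubmx y *m N)).
  by split=> //; [apply/spanA; eexists | apply/spanU; eexists].
rewrite -[y]hsubmxK lcomb_row_mx comb_N; set y1 := lsubmx y; set y2 := rsubmx y.
move=> /eqP; rewrite addrC addr_eq0 => /eqP yE.
have : E (lcomb bU (y2 *m N)).
  apply/EUA; split; first by apply/spanU; eexists.
  by rewrite yE; apply/spanA; exists (- y1); rewrite lcombN.
case/spanE => z zE.
have {}zE : y2 *m N = z *m M.
  apply/eqP; rewrite -subr_eq0; apply/eqP/freeU.
  by rewrite lcombD lcombN zE subrr.
have y20 : y2 = 0.
  have : (y2 *m N <= M :&: M^C)%MS.
    rewrite sub_capmx {1}zE submxMl (submx_trans (submxMl _ _)) //.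
    by rewrite eq_row_base.
  rewrite capmx_compl submx0 => /eqP yN0.
  by apply: (row_free_inj (row_base_free (M^C)%MS)); rewrite mul0mx.
suff -> : y1 = 0 by rewrite y20 row_mx0.
apply: freeA; apply/eqP; rewrite -oppr_eq0 -yE y20 mul0mx.
by rewrite /lcomb big1 ?raddf0 // => j _; rewrite mxE scale0r.
Qed.

(** * Numerators of Hilbert series *)

Section Numerator.
Variable n : nat.
Implicit Types (h : nat -> int).

(** The coefficient of [t^k] in [(1 - t)^n] times the series with coefficients
    [h]. *)
Definition numer_coef h k : int :=
  \sum_(i < k.+1) ((1 - 'X) ^+ n : {poly int})`_i * h (k - i)%N.

Lemma numer_coefD h h' k : numer_coef (fun i => h i + h' i) k = numer_coef h k + numer_coef h' k.
Proof. by rewrite -big_split; apply: eq_bigr => i _; rewrite mulrDr. Qed.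

Lemma numer_coefN h k : numer_coef (fun i => - h i) k = - numer_coef h k.
Proof. by rewrite -sumrN; apply: eq_bigr => i _; rewrite mulrN. Qed.

Lemma eq_numer_coef h h' : h =1 h' -> numer_coef h =1 numer_coef h'.
Proof. by move=> hh k; apply: eq_bigr => i _; rewrite hh. Qed.

Lemma numer_coef_shift h d k :
  numer_coef (fun i => if (d <= i)%N then h (i - d)%N else 0) k
  = if (d <= k)%N then numer_coef h (k - d) else 0.
Proof.
rewrite /numer_coef; case: leqP => [dk|kd]; last first.
  by rewrite big1 // => i _; rewrite leqNgt (leq_ltn_trans (leq_subr _ _) kd) mulr0.
have le : ((k - d).+1 <= k.+1)%N by rewrite ltnS leq_subr.
rewrite [RHS](big_ord_widen_cond k.+1 xpredT
  (fun i => ((1 - 'X) ^+ n : {poly int})`_i * h (k - d - i)%N) le) big_mkcond.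
rewrite [RHS]big_mkcond; apply: eq_bigr => i _ /=.
have -> : (d <= k - i)%N = (i < (k - d).+1)%N by have := ltn_ord i; lia.
by case: ifP; rewrite ?mulr0 // subnAC.
Qed.

End Numerator.

(** The number of monomials of degree [k]; without variables the formula by
    binomial coefficients breaks down. *)
Definition ring_hilbert n k : nat :=
  if n is n'.+1 then 'C(k + n', k) else (k == 0)%N.

(** The Hilbert series of [R] is the inverse of [(1 - t)^n]: by Pascal's rule,
    multiplying it by [1 - t] removes one variable. *)
Lemma numer_coef_ring n k :
  numer_coef n (fun i => (ring_hilbert n i)%:Z) k = (k == 0%N)%:R.
Proof.
elim: n k => [|n IHn] k.
  rewrite /numer_coef expr0 big_ord_recl /= big1 => [|i _].
    by rewrite coef1 mul1r subn0 addr0; case: k.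
  by rewrite coef1 mul0r.
(* Truncating the series after degree k keeps the computation in polynomials. *)
pose T := \poly_(i < k.+1) (ring_hilbert n.+1 i)%:Z.
transitivity (((1 - 'X) ^+ n.+1 * T)`_k).
  rewrite coefM; apply: eq_bigr => i _; rewrite coef_poly ifT //.
  by rewrite ltnS leq_subr.
rewrite exprSr -mulrA coefM -IHn; apply: eq_bigr => i _; congr (_ * _).
move: (k - i)%N (leq_subr i k) => j jk.
rewrite mulrBl mul1r coefB coefXM !coef_poly ltnS jk.
case: j jk => [|j] jk /=; first by rewrite subr0 bin0; case: (n) => //= ?; rewrite bin0.
rewrite ltnS (ltnW jk) addSn binS PoszD; case: (n) => [|n'] /=.
  by rewrite addn0 bin_small // binn.
by rewrite addrK addnS addSn.
Qed.

Lemma has_dim_homog (K : fieldType) n k :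
  has_dim (fun p : {mpoly K[n]} => p \is k.-homog) (ring_hilbert n k).
Proof.
case: n => [|n].
  have const p : p = p@_0%MM *: 1 :> {mpoly K[0]}.
    rewrite -mul_mpolyC mulr1; apply/mpolyP => m; rewrite mcoeffC.
    have -> : m = 0%MM by apply/mnmP => -[].
    by rewrite eqxx mulr1.
  exists (fun=> 1); case: k => [|k] /=; split.
  - move=> p; split=> _; first by exists (fun=> p@_0%MM); rewrite big_ord1 -const.
    exact: nvar0_homog.
  - move=> c; rewrite big_ord1 => /(congr1 (mcoeff 0%MM)) c0 j.
    by move: c0; rewrite mcoeffZ mcoeff1 eqxx mulr1 mcoeff0 (ord1 j).
  - move=> p; split=> [hp|[c ->]].
      exists (fun=> 0); rewrite big_ord0 (const p).
      by rewrite (dhomog_nemf_coeff hp) ?scale0r //= mdeg0.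
    by rewrite big_ord0 dhomog0.
  - by move=> c _ [].
have [f flin [g fK gK]] := dhomog_vecaxiom n K k.
pose fL : {linear dhomog n.+1 K k -> 'rV[K]_('C(k + n, k))} :=
  HB.pack f (GRing.isLinear.Build K _ _ _ f flin).
have glin : linear g by apply: (@can2_linear _ _ _ fL).
pose gL : {linear 'rV[K]_('C(k + n, k)) -> dhomog n.+1 K k} :=
  HB.pack g (GRing.isLinear.Build K _ _ _ g glin).
pose b i := mpoly_of_dhomog (gL (delta_mx 0 i)).
have bE y : lcomb b y = mpoly_of_dhomog (gL y).
  rewrite {2}[y]row_sum_delta (linear_sum gL) linear_sum.
  by apply: eq_bigr => i _; rewrite (linearZ_LR gL) linearZ.
apply/has_dimP; exists b; split=> [p|y].
  split=> [hp|[y ->]]; last by rewrite bE; apply: dhomog_is_dhomog.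
  by exists (f (DHomog hp)); rewrite bE /= fK.
rewrite bE => y0; rewrite -[y]gK; have -> : g y = 0 by apply: val_inj.
exact: (linear0 fL).
Qed.

(** * Adding one generator *)

Section Resolved.
Variables (n : nat) (K : fieldType).
Implicit Types (I : {mpoly K[n]} -> Prop) (T : nat -> int -> Prop).

Lemma resolution_homog_part I (F : free_seq n K) z p :
  graded_resolution I F -> I p -> I (homog_part z p).
Proof.
case=> _ ha hI _ _ /hI[v ->]; apply/hI.
exists (\row_a homog_part (z - fshift a) (v 0 a)).
rewrite !mxE homog_part_sum; apply: eq_bigr => a _.
by rewrite mxE -(homog_partM _ _ (ha a)) subrK.
Qed.

Definition degree_part I k p := I p /\ p \is k.-homog.

(** The data carried along when generators are added one at a time.  [T] is any
    region containing the pairs (homological degree, degree) of the generators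
    of the resolution [F]; [h] is the Hilbert function and [N] its numerator.
    The last clause records the one fact needed from the formula that expresses
    [N] as the alternating sum of [t^j] over the generators. *)
Definition resolved I T := exists F : free_seq n K, exists h : nat -> nat,
  exists N : {poly int},
  [/\ graded_resolution I F,
      forall i (a : 'I_(frank F i)), T i (fshift a),
      forall k, has_dim (degree_part I k) (h k),
      forall k, N`_k = numer_coef n (fun i => (h i)%:Z) k
    & forall k, N`_k != 0 -> exists i (a : 'I_(frank F i)), fshift a = k].

Lemma eq_ideal I I' : (forall p, I p <-> I' p) -> I = I'.
Proof.
by move=> II'; apply: functional_extensionality => p; apply: propositional_extensionality.
Qed.

Lemma resolved_zero T : resolved (fun p => p = 0) T.
Proof.
exists (zero_seq n K), (fun=> 0%N), 0; split=> [|? []//|k|k|k].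
- exact: zero_resolution.
- apply/has_dimP; exists (fun=> 0); split=> [p|y _]; last exact: thinmx0.
  split=> [[-> _]|[y ->]]; first by exists 0; rewrite /lcomb big_ord0.
  by rewrite /lcomb big_ord0; split; rewrite ?dhomog0.
- by rewrite coef0 /numer_coef big1 // => i _; rewrite mulr0.
- by rewrite coef0 eqxx.
Qed.

(** Taking components of degree [k] in [p = q + c * g]; an ideal with a graded
    resolution is homogeneous. *)
Lemma degree_part_ideal_add I (F : free_seq n K) g d k p :
    graded_resolution I F -> g \is d.-homog ->
  degree_part (ideal_add I g) k p <->
  if (d <= k)%N then
    exists x w, [/\ degree_part I k x, w \is (k - d).-homog & p = x + w * g]
  else degree_part I k p.
Proof.
move=> resF hg; have hgz : zhomog d%:Z g by [].
have split_p : degree_part (ideal_add I g) k p ->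
    exists x c, degree_part I k x /\ p = x + homog_part (k%:Z - d%:Z) c * g.
  case=> -[q Iq [c pE]] hp; exists (homog_part k%:Z q), c; split.
    by split; [exact: resolution_homog_part resF Iq | exact: (homog_partP k%:Z)].
  rewrite -(homog_partM _ _ hgz) subrK -[LHS](homog_part_id (z := k%:Z) hp) pE.
  exact: raddfD.
have I0 : I 0 by case: resF => _ _ hI _ _; apply/hI; exists 0; rewrite mul0mx mxE.
case: leqP => [dk|kd]; split.
- case/split_p => x [c [Ix ->]]; exists x, (homog_part (k%:Z - d%:Z) c).
  by split=> //; rewrite subzn //; apply: (homog_partP (k - d)%:Z).
- case=> x [w [[Ix hx] hw ->]]; split; first by exists x => //; exists w.
  by rewrite rpredD // -(subnK dk) dhomogM.
- case/split_p => x [c [Ix ->]].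
  have -> : k%:Z - d%:Z = Negz (d - k).-1 by rewrite NegzE; lia.
  by rewrite mul0r addr0.
- by case=> Ip hp; split=> //; exists p => //; exists 0; rewrite mul0r addr0.
Qed.

(** The Hilbert function form of the exact sequence
    [0 -> I -> I + (g) -> (R / (I : g))(-d) -> 0]. *)
Lemma has_dim_ideal_add I (F : free_seq n K) g d (h h' : nat -> nat) k :
    graded_resolution I F -> g \is d.-homog ->
    (forall k, has_dim (degree_part I k) (h k)) ->
    (forall k, has_dim (degree_part (colon I g) k) (h' k)) ->
  (h' k <= ring_hilbert n k)%N /\
  has_dim (degree_part (ideal_add I g) k)
    (h k + (if d <= k then ring_hilbert n (k - d) - h' (k - d) else 0))%N.
Proof.
move=> resF hg hI hI'; split.
  by apply: has_dim_le (hI' k) (has_dim_homog K n k) _ => p [].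
have EI : degree_part (ideal_add I g) k = _ :=
  eq_ideal (fun p => degree_part_ideal_add k p resF hg).
rewrite {}EI; case: leqP => [dk|kd]; last by rewrite addn0.
have mul_linear : linear (fun p : {mpoly K[n]} => p * g).
  by move=> c p q; rewrite mulrDl scalerAl.
pose phi : {linear {mpoly K[n]} -> {mpoly K[n]}} :=
  HB.pack (fun p : {mpoly K[n]} => p * g) (GRing.isLinear.Build K _ _ _ _ mul_linear).
apply: (proj2 (has_dim_add (phi := phi) (hI k) (has_dim_homog K n (k - d))
  (hI' (k - d)%N) _ _)) => [w|p] //=.
split=> [[Iw hw]|[hw [Iw _]]] //; split=> //; split=> //.
by rewrite -(subnK dk) dhomogM.
Qed.

(** One step of the construction.  The three conditions on [T] correspond to the
    generators of [F], to the new generator [g], and to the generators of the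
    resolution of the colon ideal, which move up by one homological degree and
    by [d]. *)
Lemma resolved_add I g d T1 T2 T : g \is d.-homog ->
    resolved I T1 -> resolved (colon I g) T2 ->
    (forall i j, T1 i j -> T i j) -> T 0 d%:Z ->
    (forall i j, T2 i j -> T i.+1 (j + d%:Z)) ->
  resolved (ideal_add I g) T.
Proof.
move=> hg [F [hF [NF [resF TF dimF NFE NFs]]]] [H [hH [NH [resH TH dimH NHE NHs]]]].
move=> T1T T0 T2T.
have [|tau resC] := cone_resolution (d := d%:Z) _ resF resH; first by [].
pose N := NF + 'X^d * (1 - NH).
have hC k := has_dim_ideal_add k resF hg dimF dimH.
eexists (cone d%:Z tau), _, N; split=> [|i a|k|k|k].
- exact: resC.
- move: a => /= a; case: (split a) => b; first by apply/T1T/TF.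
  by case: i b {a} => [|i] b /=; [rewrite add0r | apply/T2T/TH].
- exact: (proj2 (hC k)).
- rewrite coefD coefXnM NFE.
  rewrite [RHS](@eq_numer_coef n _ (fun i => (hF i)%:Z +
    (if (d <= i)%N then (ring_hilbert n (i - d)%N)%:Z - (hH (i - d)%N)%:Z else 0))).
    rewrite numer_coefD (numer_coef_shift _ (fun i => (ring_hilbert n i)%:Z - (hH i)%:Z)).
    rewrite ltnNge; case: leqP => //= dk.
    by rewrite coefB coef1 numer_coefD numer_coefN numer_coef_ring NHE.
  move=> i; rewrite PoszD; congr (_ + _); case: leqP => // di.
  by rewrite subzn //; have [] := hC (i - d)%N.
- have [NF0|/NFs[i [a sa]] _] := eqVneq (NF`_k) 0; last first.
    by exists i, (lshift _ a); rewrite /= (unsplitK (inl a)).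
  rewrite coefD NF0 add0r coefXnM; case: ltnP => // dk.
  rewrite coefB coef1; have [kd _|kd] := eqVneq (k - d)%N 0%N.
    exists 0%N, (rshift _ ord0); rewrite /= (unsplitK (inr ord0)) /=; lia.
  rewrite sub0r oppr_eq0 => /NHs[i [a sa]].
  by exists i.+1, (rshift _ a); rewrite /= (unsplitK (inr a)) /= sa; lia.
Qed.

Lemma ideal_gen_add (J : finType) (A : pred J) (g : J -> {mpoly K[n]}) j0 :
  ~~ A j0 -> ideal_gen (predU1 j0 A) g = ideal_add (ideal_gen A g) (g j0).
Proof.
move=> nA; apply: eq_ideal => p; split=> [[c ->]|[q [c ->] [b ->]]].
  exists (\sum_(j | A j) c j * g j); first by exists c.
  exists (c j0); rewrite (bigD1 j0) /= ?eqxx // addrC; congr (_ + _).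
  apply: eq_bigl => j; case: eqVneq => [->|_] /=; last by rewrite andbT.
  by rewrite (negbTE nA).
exists (fun j => if j == j0 then b else c j).
rewrite [RHS](bigD1 j0) /= ?eqxx // addrC; congr (_ + _).
transitivity (\sum_(j | A j) (if j == j0 then b else c j) * g j).
  by apply: eq_bigr => j Aj; case: eqVneq Aj nA => [-> ->|].
apply: eq_bigl => j; case: eqVneq => [->|_] /=; last by rewrite andbT.
by rewrite (negbTE nA).
Qed.

Lemma eq_ideal_gen (J : finType) (A B : pred J) (g : J -> {mpoly K[n]}) :
  A =1 B -> ideal_gen A g = ideal_gen B g.
Proof.
move=> AB; apply: eq_ideal => p.
by split=> -[c ->]; exists c; [symmetry|]; apply: eq_bigl.
Qed.

Definition ideal_upto m (g : 'I_m -> {mpoly K[n]}) (s : nat) :=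
  ideal_gen (fun i : 'I_m => (i < s)%N) g.

Lemma ideal_upto0 m (g : 'I_m -> {mpoly K[n]}) :
  ideal_upto g 0 = fun p => p = 0.
Proof.
apply: eq_ideal => p; split=> [[c ->]|->]; first by rewrite big_pred0.
by exists (fun=> 0); rewrite big_pred0.
Qed.

Lemma resolved_upto m (g : 'I_m -> {mpoly K[n]}) (T : nat -> nat -> int -> Prop) :
    (forall i : 'I_m, resolved (ideal_upto g i) (T i) ->
      resolved (ideal_add (ideal_upto g i) (g i)) (T i.+1)) ->
  resolved (ideal_gen xpredT g) (T m).
Proof.
move=> step; suff ind s : (s <= m)%N -> resolved (ideal_upto g s) (T s).
  rewrite -(eq_ideal_gen (A := fun i : 'I_m => (i < m)%N)); first exact: ind.
  by move=> i; rewrite ltn_ord.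
elim: s => [_|s IHs sm]; first by rewrite ideal_upto0; apply: resolved_zero.
have := step (Ordinal sm) (IHs (ltnW sm)); rewrite /ideal_upto -ideal_gen_add /= ?ltnn //.
rewrite (@eq_ideal_gen _ _ (fun i : 'I_m => (i < s.+1)%N)) // => i /=.
by rewrite [RHS]ltnS [RHS]leq_eqVlt.
Qed.

(** Where the Koszul resolution of the ideal generated by the first [s] members
    of a regular sequence of degrees [a] lives.  As it resolves the ideal and not
    the quotient, a generator in homological degree [i] comes from a product of
    [i.+1] members, so [i < s] and its degree exceeds [i.+1] by a sum of some
    [(a t).-1]. *)
Definition koszul_bound r (a : 'I_r -> nat) s i (j : int) :=
  (i < s)%N /\ j <= (i.+1 + \sum_(t < r | t < s) (a t).-1)%N%:Z.

(** Each member is regular modulo the previous ones, so the colon ideal is the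
    ideal already resolved and the cone doubles its resolution. *)
Lemma resolved_regular r (g : 'I_r -> {mpoly K[n]}) (a : 'I_r -> nat) :
    regular_seq g -> (forall t, g t \is (a t).-homog) -> (forall t, 0 < a t)%N ->
  resolved (ideal_gen xpredT g) (koszul_bound a r).
Proof.
case=> reg _ hg a0; apply: (resolved_upto (T := koszul_bound a)) => t resI.
have colonE : colon (ideal_upto g t) (g t) = ideal_upto g t.
  apply: eq_ideal => p; split; first exact: reg.
  case=> c ->; exists (fun i => c i * g t); rewrite mulr_suml.
  by apply: eq_bigr => i _; rewrite mulrAC.
have sumS : (\sum_(i < r | i < t.+1) (a i).-1 =
             (a t).-1 + \sum_(i < r | i < t) (a i).-1)%N.
  rewrite (bigD1 t) //=; congr (_ + _)%N; apply: eq_bigl => i.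
  by rewrite ltnS ltn_neqAle andbC.
have at0 := a0 t.
apply: (resolved_add (hg t) resI); rewrite ?colonE; first exact: resI.
- by move=> i j [it jb]; split; [exact: ltnW | rewrite sumS; lia].
- by split; rewrite ?sumS; lia.
- by move=> i j [it jb]; split; rewrite ?sumS; lia.
Qed.

(** A coefficient of the numerator in degree [P + Q] provides a generator of that
    degree, and the bounds leave only homological degree [P] for it. *)
Lemma resolved_extremal I T (P Q : nat) : resolved I T ->
    (forall i j, T i j -> (i <= P)%N /\ j <= (i + Q)%N%:Z) ->
    (0 < P)%N -> (P + Q)%N = hilbert_deg I ->
  (forall i j, betti I i j <> 0%N -> (i <= P)%N /\ j <= (i + Q)%N%:Z)
  /\ betti I P (P + Q)%N%:Z <> 0%N.
Proof.
case=> F [h [N [resF TF dimF NE Nshift]]] Tb P0 PQ.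
have hE k : hilbert_fun I k = h k by exact: (dim_eq (dimF k)).
have NI : is_hilbert_numerator I N.
  by move=> k; rewrite NE; apply: eq_bigr => i _; rewrite hE.
have NN : hilbert_numerator I = N.
  have : is_hilbert_numerator I (hilbert_numerator I) by apply: epsilon_spec; exists N.
  by move=> HN; apply/polyP => k; rewrite HN NI.
have [i [a sa]] : exists i (a : 'I_(frank F i)), fshift a = (P + Q)%N.
  apply: Nshift; rewrite PQ /hilbert_deg NN -lead_coefE lead_coef_eq0.
  apply/eqP => N0; move: PQ; rewrite /hilbert_deg NN N0 size_poly0 /=; lia.
have conc k (b : 'I_(frank F k)) : fshift b = (P + Q)%N -> k = P.
  by move=> sb; have := Tb _ _ (TF _ b); rewrite sb; lia.
split=> [i' j /eqP bij|].
  have : tor_dim F i' j <> 0%N by move/(betti_resolution resF)/eqP; rewrite (negbTE bij).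
  by case/(tor_dim_shift resF) => b <-; apply: Tb.
move/(betti_resolution resF)/(tor_dim_concentrated resF conc).
by have iP := conc _ _ sa; subst i => /(_ a); rewrite sa eqxx.
Qed.

End Resolved.

(** * Monomial generators *)

Section Monomials.
Variables (n : nat) (K : fieldType).

Lemma ideal_gen_mem (J : finType) (A : pred J) (g : J -> {mpoly K[n]}) c j :
  A j -> ideal_gen A g (c * g j).
Proof.
move=> Aj; exists (fun i => if i == j then c else 0).
rewrite (bigD1 j) //= eqxx big1 ?addr0 // => i /andP[_ /negbTE ->].
by rewrite mul0r.
Qed.

Lemma min_generates_nonredundant (J : finType) (g : J -> {mpoly K[n]}) I i j c :
  min_generates g I -> i != j -> g i <> c * g j.
Proof.
case=> Ig minI ij gE; apply: (minI ([set: J] :\ i)).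
  by apply: properD1.
move=> p; rewrite Ig; split=> -[b ->].
  exists (fun k => if k == j then b j + b i * c else b k).
  have jA : j \in [set: J] :\ i by rewrite !inE eq_sym ij.
  have iT : xpredT i by [].
  rewrite (bigD1 i) // [RHS](bigD1 j) //= eqxx (bigD1 j) 1?eq_sym //=.
  rewrite mulrDl -mulrA -gE addrCA addrA; congr (_ + _).
  apply: eq_big => [k|k /andP[_ /negbTE->]] //.
  by rewrite !inE andbT.
exists (fun k => if k == i then 0 else b k).
rewrite [RHS](bigD1 i) //= eqxx mul0r add0r.
apply: eq_big => [k|k]; first by rewrite !inE andbT.
by rewrite !inE andbT => /negbTE->.
Qed.

Lemma monomial_multiple (c : {mpoly K[n]}) (k m : 'X_{1..n}) :
  'X_[k] = c * 'X_[m] -> exists m', k = (m + m')%MM.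
Proof.
move=> kE; have : k \in msupp (c * 'X_[m]) by rewrite -kE msuppX inE.
by rewrite (perm_mem (msuppMX c m)) => /mapP[m' _ ->]; exists m'.
Qed.

Lemma regular_monomial_deg_gt0 r (a : 'I_r -> 'X_{1..n}) i :
  regular_seq (fun i => 'X_[a i] : {mpoly K[n]}) -> (0 < mdeg (a i))%N.
Proof.
case=> _ ng1; rewrite lt0n mdeg_eq0; apply/eqP => ai0; apply: ng1.
have <- : 1 * 'X_[a i] = 1 :> {mpoly K[n]} by rewrite ai0 mpolyX0 mulr1.
exact: (ideal_gen_mem (fun i => 'X_[a i])).
Qed.

End Monomials.

Lemma sum_predn r (a : 'I_r -> nat) : (forall i, 0 < a i)%N ->
  (\sum_i a i = \sum_i (a i).-1 + r)%N.
Proof.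
move=> a0; transitivity (\sum_(i < r) ((a i).-1 + 1))%N.
  by apply: eq_bigr => i _; rewrite addn1 prednK.
by rewrite big_split /= sum1_card card_ord.
Qed.

(** The first colon ideal contains the first monomial, so it is not zero.  Each
    of its generators [a] makes [a * f_2] a multiple of [f_1], and a proper one:
    otherwise [f_1] would be a multiple of [f_2], against minimality.  Hence
    [deg f_1 <= deg f_2 + deg a - 1], which is at most [Q]. *)
Lemma first_colon_bounds (K : fieldType) (n m : nat) (I : {mpoly K[n]} -> Prop)
    (f : 'I_m -> 'X_{1..n}) (i0 i1 : 'I_m) r (a : 'I_r -> 'X_{1..n}) :
    min_generates (fun k => 'X_[f k]) I -> i0 = 0%N :> nat -> i1 = 1%N :> nat ->
    (forall p : {mpoly K[n]},
       colon (ideal_gen (fun j : 'I_m => (j < i1)%N) (fun j => 'X_[f j]))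
             'X_[f i1] p
       <-> ideal_gen xpredT (fun i => 'X_[a i]) p) ->
  (0 < r)%N /\ forall i, (mdeg (f i0) < mdeg (f i1) + mdeg (a i))%N.
Proof.
move=> minI i00 i11 colE; split.
  case: r a colE => // a colE.
  have : ideal_gen xpredT (fun i => 'X_[a i]) ('X_[f i0] : {mpoly K[n]}).
    by apply/colE; rewrite /colon mulrC; apply: ideal_gen_mem; rewrite i00 i11.
  by case=> c /eqP; rewrite big_ord0 -msupp_eq0 msuppX.
move=> i; have : ideal_gen xpredT (fun i => 'X_[a i]) (1 * 'X_[a i] : {mpoly K[n]}).
  exact: (ideal_gen_mem (fun i => 'X_[a i])).
case/colE => c; rewrite (big_pred1 i0) => [|j]; last first.
  by rewrite /= i11 ltnS leqn0 -i00.
rewrite mul1r -mpolyXD => /monomial_multiple[m' mE].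
have := congr1 mdeg mE; rewrite !mdegD addnC => ->.
rewrite -[X in (X < _)%N]addn0 ltn_add2l lt0n mdeg_eq0; apply/eqP => m'0.
apply: (min_generates_nonredundant (i := i0) (j := i1) (c := 'X_[a i]) minI).
  by rewrite -val_eqE /= i00 i11.
by rewrite -mpolyXD mE m'0 addm0.
Qed.

Theorem corollary2p2 (K : fieldType) (n m : nat) (I : {mpoly K[n]} -> Prop)
    (f : 'I_m -> 'X_{1..n}) (r : 'I_m -> nat)
    (alpha : forall k : 'I_m, 'I_(r k) -> 'X_{1..n})
    (m_ge2 : (2 <= m)%N)
    (I_f : min_generates (fun k => 'X_[f k]) I)
    (reg_alpha : forall k : 'I_m, (0 < k)%N ->
       regular_seq (fun i => 'X_[alpha k i] : {mpoly K[n]}))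
    (colon_alpha : forall k : 'I_m, (0 < k)%N -> forall p : {mpoly K[n]},
       colon (ideal_gen (fun j : 'I_m => (j < k)%N) (fun j => 'X_[f j]))
             'X_[f k] p
       <-> ideal_gen xpredT (fun i => 'X_[alpha k i]) p)
    (PQ_D : (Pmax r + Qmax f alpha)%N = hilbert_deg I) :
  [/\ is_reg I (Qmax f alpha)%:Z,
      is_pdim I (Pmax r),
      extremal I (Pmax r) (Qmax f alpha)%:Z
    & forall (i : nat) (j : int),
        extremal I i j -> i = Pmax r /\ j = (Qmax f alpha)%:Z].
Proof.
set P := Pmax r; set Q := Qmax f alpha.
have a_gt0 (k : 'I_m) : (0 < k)%N -> forall i, (0 < mdeg (alpha k i))%N.
  by move=> k0 i; apply: (regular_monomial_deg_gt0 i (reg_alpha k k0)).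
have rP (k : 'I_m) : (0 < k)%N -> (r k <= P)%N by move=> k0; apply: leq_bigmax_cond.
have QE (k : 'I_m) : (0 < k)%N ->
    (mdeg (f k) + \sum_(i < r k) (mdeg (alpha k i)).-1 <= Q)%N.
  move=> k0; apply: leq_trans (leq_bigmax_cond (P := fun k : 'I_m => (0 < k)%N) _ k0).
  by rewrite (sum_predn (a_gt0 k k0)) addnA addnK.
have m_gt0 : (0 < m)%N by exact: ltnW.
pose i0 := Ordinal m_gt0; pose i1 := Ordinal m_ge2.
have [r1 d0] := first_colon_bounds (i0 := i0) (i1 := i1) I_f erefl erefl
  (colon_alpha i1 isT).
have P0 : (0 < P)%N by apply: leq_trans r1 (rP i1 isT).
have d0Q : (mdeg (f i0) <= Q)%N.
  apply: leq_trans (QE i1 isT); have i := Ordinal r1.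
  rewrite (bigD1 i) //=; have := d0 i; have := a_gt0 i1 isT i; lia.
pose T i j := (i <= P)%N /\ j <= (i + Q)%N%:Z.
have resI : resolved I T.
  have -> : I = ideal_gen xpredT (fun k => 'X_[f k]) by apply: eq_ideal (proj1 I_f).
  apply: (resolved_upto (T := fun=> T)) => k resk.
  have hX (u : 'X_{1..n}) : ('X_[u] : {mpoly K[n]}) \is (mdeg u).-homog.
    by rewrite dhomogX.
  have hf := hX (f k).
  have [k0|k0] := posnP k.
    (* The first monomial is added to the zero ideal, whose colon is zero. *)
    apply: (resolved_add (T1 := T) (T2 := fun _ _ => False) hf) => //.
      rewrite k0 ideal_upto0.
      rewrite (_ : colon _ _ = fun p => p = 0); first exact: resolved_zero.
      apply: eq_ideal => p; rewrite /colon; split=> [/eqP|->]; last by rewrite mul0r.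
      by rewrite mulf_eq0 -[in X in _ || X]msupp_eq0 msuppX orbF => /eqP.
    by split; rewrite // add0n (_ : k = i0) //; apply: val_inj.
  have resC := resolved_regular (reg_alpha k k0)
    (fun i => hX (alpha k i)) (a_gt0 k k0).
  pose T2 := koszul_bound (fun i => mdeg (alpha k i)) (r k).
  apply: (resolved_add hf resk (T2 := T2)) => //.
  - by rewrite (eq_ideal (colon_alpha k k0)).
  - by split=> //; rewrite add0n lez_nat; apply: leq_trans (QE k k0); apply: leq_addr.
  - move=> i j [ir jb]; split; first exact: leq_trans ir (rP k k0).
    move: jb (QE k k0); rewrite (eq_bigl xpredT) => [|t]; last exact: ltn_ord.
    move: (\sum_(t < r k) _)%N => S; lia.
have [bettiT bettiPQ] := resolved_extremal resI (fun i j t => t) P0 PQ_D.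
split.
- split=> [|i j /bettiT[]]; last lia.
  by exists P, (P + Q)%N%:Z; split=> //; lia.
- split=> [|i j /bettiT[] //]; by exists (P + Q)%N%:Z.
- split=> [|k l kl Pk Ql]; first by rewrite -PoszD.
  apply: NNPP => /bettiT[kP lQ]; apply: kl; congr (_, _); lia.
- move=> i j [/bettiT[iP jQ] top]; apply: NNPP => ij; apply: bettiPQ.
  rewrite PoszD; apply: top => //; last lia.
  by case=> iE jE; apply: ij.
Qed.
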